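(* Let $\mathbb{F}\in\{\mathbb{R},\mathbb{C}\}$, $p\in(0,1]$, let $k\in\{1,\dots,n\}$ be an integer, and let $r>0$ be a real number. Suppose $\boldsymbol A\in\mathbb{F}^{m\times n}$ satisfies the phaseless bi-Lipschitz condition on the set $\mathcal X=\{\boldsymbol x\in\mathbb{F}^n:\|\boldsymbol x\|_0\le (r+4)k\}$ with positive constants $L,U$, and that \[ L-U\cdot 2^{1/p-1}\cdot\Big(\frac{2}{r}\Big)^{1/p-1/2}>0 . \] Then there are positive constants $C_1,C_2,D_1,D_2$ depending only on $U,L,r,p$ such that for every $\boldsymbol x\in\mathbb{F}^n$, every $\eta\ge0$ and every $\boldsymbol e\in\mathbb{R}^m$ with $\|\boldsymbol e\|_2\le\eta$, any $\boldsymbol x^\#\in\Delta_{p,\eta}(|\boldsymbol A\boldsymbol x|+\boldsymbol e)$ satisfies \[ \mathrm{dist}_p(\boldsymbol x^\#,\boldsymbol x)\le C_1\,\sigma_k(\boldsymbol x)_p+D_1\,k^{1/p-1/2}\,\eta, \qquad \mathrm{dist}(\boldsymbol x^\#,\boldsymbol x)\le C_2\,\frac{\sigma_k(\boldsymbol x)_p}{k^{1/p-1/2}}+D_2\,\eta . \] Explicitly, with $\widetilde C_2=\dfrac{U\,(2^{1/p-1}r^{-(1/p-1/2)}+1)}{L-U2^{1/p-1}(2/r)^{1/p-1/2}}$, $\widetilde D_2=\dfrac{2}{L-U2^{1/p-1}(2/r)^{1/p-1/2}}$, $\widetilde C_1=(2+r)^{1-p/2}\widetilde C_2^{\,p}$,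 $\widetilde D_1=(2+r)^{1-p/2}\widetilde D_2^{\,p}$, one may take $C_1=2^{1/p-1}(2\widetilde C_1+2)^{1/p}$, $D_1=2^{1/p-1}\widetilde D_1^{1/p}$, $C_2=\big(1+2^{1/p-1}(r/2)^{-(1/p-1/2)}\big)\widetilde C_2+2^{1/p-1}r^{-(1/p-1/2)}+1$, $D_2=\big(1+2^{1/p-1}(r/2)^{-(1/p-1/2)}\big)\widetilde D_2$.
   Context: $\mathbb{F}\in\{\mathbb{R},\mathbb{C}\}$. For $q>0$, $\|\boldsymbol u\|_q=(\sum_i|u_i|^q)^{1/q}$ (a quasi-norm if $q<1$); $\|\boldsymbol u\|_0$ is the number of nonzero entries; $|\boldsymbol u|$ is the vector of entrywise moduli. For $\boldsymbol x,\boldsymbol y\in\mathbb{F}^n$ and $q>0$, $\mathrm{dist}_q(\boldsymbol x,\boldsymbol y)=\min_{c\in\mathbb{F},|c|=1}\|\boldsymbol x-c\boldsymbol y\|_q$ and $\mathrm{dist}=\mathrm{dist}_2$. $\Sigma_k=\{\boldsymbol z\in\mathbb{F}^n:\|\boldsymbol z\|_0\le k\}$ and $\sigma_k(\boldsymbol x)_q=\min_{\boldsymbol z\in\Sigma_k}\mathrm{dist}_q(\boldsymbol x,\boldsymbol z)$. A matrix $\boldsymbol A\in\mathbb{F}^{m\times n}$ satisfies the phaseless bi-Lipschitz condition on $\mathcal X\subset\mathbb{F}^n$ with positive constants $L,U$ if $L\,\mathrm{dist}(\boldsymbol x,\boldsymbol y)\le\||\boldsymbol A\boldsymbol x|-|\boldsymbol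 A\boldsymbol y|\|_2\le U\,\mathrm{dist}(\boldsymbol x,\boldsymbol y)$ for all $\boldsymbol x,\boldsymbol y\in\mathcal X$. For $p\in(0,1]$, $\eta\ge0$ and $\boldsymbol y\in\mathbb{R}^m$, the phaseless $\ell_p$-minimization decoder is $\Delta_{p,\eta}(\boldsymbol y)=\operatorname{argmin}_{\boldsymbol z\in\mathbb{F}^n}\{\|\boldsymbol z\|_p:\||\boldsymbol A\boldsymbol z|-\boldsymbol y\|_2\le\eta\}$ (the set of minimizers). *)

(* Defs.v *)
(* F ∈ {R, C} is handled by a generic
   development over a ring F with a modulus nrm : F -> R, instantiated in the
   theorem with (F, nrm) = (R, `|.|) and (R[i], normc). *)
From HB Require Import structures.
From mathcomp Require Import all_boot all_order all_algebra.
From mathcomp Require Import all_classical all_reals all_analysis.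
From mathcomp Require Import complex.
Set Implicit Arguments. Unset Strict Implicit. Unset Printing Implicit Defensive.
Import Order.TTheory GRing.Theory Num.Theory.
Local Open Scope classical_set_scope.
Local Open Scope ring_scope.

Section QNorm.
Variables (R : realType) (F : nzRingType) (nrm : F -> R).
Definition qnorm (q : R) (m : nat) (u : 'cV[F]_m) : R :=
  powR (\sum_(i < m) powR (nrm (u i 0)) q) q^-1.
End QNorm.

Definition rnorm2 (R : realType) (m : nat) (u : 'cV[R]_m) : R :=
  qnorm (fun a : R => `|a|) 2 u.

Section PhaselessDefs.
Variables (R : realType) (F : nzRingType) (nrm : F -> R).

Definition absv (m : nat) (u : 'cV[F]_m) : 'cV[R]_m := \col_i nrm (u i 0).


Definition l0 (m : nat) (u : 'cV[F]_m) : nat := #|[set i | u i 0 != 0]|.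

(* dist_q(x,y) = min_{|c|=1} ||x - c y||_q  (the minimum is attained, so it
   equals the infimum used here) *)
Definition distq (q : R) (n : nat) (x y : 'cV[F]_n) : R :=
  inf [set qnorm nrm q (x - c *: y) | c in [set c : F | nrm c = 1]].

Definition sigmak (k : nat) (q : R) (n : nat) (x : 'cV[F]_n) : R :=
  inf [set distq q x z | z in [set z : 'cV[F]_n | (l0 z <= k)%N]].

Definition phaseless_biLip (m n : nat) (A : 'M[F]_(m, n))
    (X : set 'cV[F]_n) (L U : R) : Prop :=
  forall x y, X x -> X y ->
    L * distq 2 x y <= rnorm2 (absv (A *m x) - absv (A *m y))
    /\ rnorm2 (absv (A *m x) - absv (A *m y)) <= U * distq 2 x y.

Definition feasible (m n : nat) (A : 'M[F]_(m, n)) (eta : R) (y : 'cV[R]_m)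
    (z : 'cV[F]_n) : Prop :=
  rnorm2 (absv (A *m z) - y) <= eta.

Definition decoder (m n : nat) (A : 'M[F]_(m, n)) (p eta : R) (y : 'cV[R]_m)
    : set 'cV[F]_n :=
  [set xs | feasible A eta y xs /\
            forall z, feasible A eta y z -> qnorm nrm p xs <= qnorm nrm p z].

End PhaselessDefs.

Section Constants.
Variables (R : realType) (U L r p : R).
Definition denom : R := L - U * powR 2 (p^-1 - 1) * powR (2 / r) (p^-1 - 2^-1).
Definition Ct2 : R :=
  U * (powR 2 (p^-1 - 1) * powR r (- (p^-1 - 2^-1)) + 1) / denom.
Definition Dt2 : R := 2 / denom.
Definition Ct1 : R := powR (2 + r) (1 - p / 2) * powR Ct2 p.
Definition Dt1 : R := powR (2 + r) (1 - p / 2) * powR Dt2 p.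
Definition C1 : R := powR 2 (p^-1 - 1) * powR (2 * Ct1 + 2) p^-1.
Definition D1 : R := powR 2 (p^-1 - 1) * powR Dt1 p^-1.
Definition C2 : R :=
  (1 + powR 2 (p^-1 - 1) * powR (r / 2) (- (p^-1 - 2^-1))) * Ct2
  + powR 2 (p^-1 - 1) * powR r (- (p^-1 - 2^-1)) + 1.
Definition D2 : R :=
  (1 + powR 2 (p^-1 - 1) * powR (r / 2) (- (p^-1 - 2^-1))) * Dt2.
End Constants.

Definition thm22_for (R : realType) (F : nzRingType) (nrm : F -> R) : Prop :=
  forall (m n k : nat) (p r L U : R) (A : 'M[F]_(m, n)),
    0 < p -> p <= 1 ->
    (1 <= k)%N -> (k <= n)%N ->
    0 < r -> 0 < L -> 0 < U ->
    phaseless_biLip nrm A [set x | (l0 x)%:R <= (r + 4) * k%:R] L U ->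
    0 < L - U * powR 2 (p^-1 - 1) * powR (2 / r) (p^-1 - 2^-1) ->
    forall (x : 'cV[F]_n) (eta : R) (e : 'cV[R]_m),
      0 <= eta -> rnorm2 e <= eta ->
      forall xs, decoder nrm A p eta (absv nrm (A *m x) + e) xs ->
        distq nrm p xs x
          <= C1 U L r p * sigmak nrm k p x
             + D1 U L r p * powR k%:R (p^-1 - 2^-1) * eta
        /\ distq nrm 2 xs x
          <= C2 U L r p * (sigmak nrm k p x / powR k%:R (p^-1 - 2^-1))
             + D2 U L r p * eta.

(* Main.v *)
(* Write z for the minimizer, a = 1/p - 1/2 and sigma for the best k-term error.
   Let S carry the k largest entries of x, T0 the 2k largest, and let T add to T0
   the t = floor(rk) + 1 largest entries of z outside T0, so that |T| <= (r+3)k.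
   Cutting the remaining entries into decreasing blocks (of size k for x, t for z)
   bounds the tails of x and z, and their images under A, by sigma / k^a and by
   t^-a |z_{S^c}|_p.  Minimality of z gives, for every unimodular c,
   |z_{S^c}|_p^p <= |(z - c x)_S|_p^p + sigma^p, so both tails are controlled by
   |z_T - c x_{T0}|_2 and sigma.  The lower Lipschitz bound on the pair
   (z_T, x_{T0}) then absorbs the first of these; taking the infimum over c only
   at the very end avoids having to know that it is attained.

   Using the cone inequality on S rather than on T0 is what makes the stated D1
   (which has no factor 2 in front of Dt1) reachable: the factor is absorbed by
   2 <= (2 + r)^(1 - p/2), which holds because L <= U forces r >= 2. *)
Require Import Defs.
From HB Require Import structures.
From mathcomp Require Import all_boot all_order all_algebra.
From mathcomp Require Import all_classical all_reals all_analysis.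
From mathcomp Require Import complex lra ring zify.
Set Implicit Arguments. Unset Strict Implicit. Unset Printing Implicit Defensive.
Import Order.TTheory GRing.Theory Num.Theory.
Local Open Scope ring_scope.

(** * Inequalities for real powers with exponents below and above 1; Minkowski's inequality *)

Section PowR.
Variable R : realType.
Implicit Types a b p q r : R.

Lemma ler_powRl a b r : 0 <= r -> 0 <= a -> a <= b -> a `^ r <= b `^ r.
Proof.
move=> r0 a0 ab; apply: ge0_ler_powR => //; rewrite nnegrE //.
exact: le_trans ab.
Qed.

Lemma powRK a p : 0 <= a -> p != 0 -> (a `^ p) `^ p^-1 = a.
Proof. by move=> a0 p0; rewrite -powRrM divff // powRr1. Qed.

Lemma powRVK a p : 0 <= a -> p != 0 -> (a `^ p^-1) `^ p = a.
Proof. by move=> a0 p0; rewrite -powRrM mulVf // powRr1. Qed.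

Lemma ler_powRV a b p : 0 < p -> 0 <= a -> 0 <= b ->
  a `^ p <= b -> a <= b `^ p^-1.
Proof.
move=> p0 a0 b0 ab; rewrite -[a in a <= _](@powRK a p) ?gt_eqF //.
by apply: ler_powRl; rewrite ?powR_ge0 ?invr_ge0 // ltW.
Qed.

(** A fraction [c / (a + b)] in [0, 1] lies below its own [p]-th power because [p <= 1]; for [c = a]
    and [c = b] the two fractions add up to 1. *)
Lemma powR_subadditive a b p : 0 < p -> p <= 1 -> 0 <= a -> 0 <= b ->
  (a + b) `^ p <= a `^ p + b `^ p.
Proof.
move=> p0 p1 a0 b0.
have [s0|s0] := eqVneq (a + b) 0.
  by rewrite s0 powR0 ?gt_eqF // addr_ge0 ?powR_ge0.
have sp : 0 < a + b by rewrite lt_def s0 addr_ge0.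
have key c : 0 <= c -> c <= a + b -> (c / (a + b)) * (a + b) `^ p <= c `^ p.
  rewrite le_eqVlt => /predU1P[<- _|c0 cs]; first by rewrite !mul0r powR_ge0.
  rewrite -{2}(divfK s0 c) powRM ?divr_ge0 ?(ltW c0) ?(ltW sp) //.
  rewrite ler_wpM2r ?powR_ge0 // ger1_powR //.
  by rewrite divr_gt0 //= ler_pdivrMr // mul1r.
have Ha := key a a0 _; have Hb := key b b0 _.
have -> : (a + b) `^ p = a / (a + b) * (a + b) `^ p + b / (a + b) * (a + b) `^ p.
  by rewrite -!mulrDl divff // mul1r.
by rewrite lerD ?Ha ?Hb // ?lerDl ?lerDr.
Qed.

(** Subadditivity for the exponent [q^-1], applied to the [q]-th powers of [a] and [b]. *)
Lemma powR_superadditive a b q : 1 <= q -> 0 <= a -> 0 <= b ->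
  a `^ q + b `^ q <= (a + b) `^ q.
Proof.
move=> q1 a0 b0; have q0 : 0 < q by exact: lt_le_trans q1.
have h : (a `^ q + b `^ q) `^ q^-1 <= a + b.
  apply: le_trans (@powR_subadditive _ _ q^-1 _ _ _ _) _;
    rewrite ?powR_ge0 ?invr_gt0 ?invf_le1 //.
  by rewrite !powRK ?gt_eqF.
rewrite -(@powRVK (a `^ q + b `^ q) q) ?gt_eqF ?addr_ge0 ?powR_ge0 //.
by apply: ler_powRl; rewrite ?powR_ge0 // ltW.
Qed.

(** Midpoint convexity of the power, rescaled by 2. With [q = p^-1] this is the source of the
    factors [2 ^ (1/p - 1)] in the constants. *)
Lemma powRD_le_convex a b q : 1 <= q -> 0 <= a -> 0 <= b ->
  (a + b) `^ q <= 2 `^ (q - 1) * (a `^ q + b `^ q).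
Proof.
move=> q1 a0 b0.
have h2 : (2^-1 * a + 2^-1 * b) `^ q <= 2^-1 * a `^ q + 2^-1 * b `^ q.
  rewrite {2 4}(_ : 2^-1 = 1 - 2^-1); last by rewrite {2}(splitr 1) div1r addrK.
  by apply: (convex_powR q1 (Itv01 _ _)) => //=;
    rewrite ?inE/= ?in_itv/= ?a0 ?b0 // ?invr_ge0// invf_le1 ?ler1n.
have -> : a + b = 2 * (2^-1 * a + 2^-1 * b).
  by rewrite -mulrDr mulVKf // pnatr_eq0.
rewrite powRM ?addr_ge0 ?mulr_ge0 ?invr_ge0 //.
rewrite powRB ?powRr1 //; last by rewrite pnatr_eq0 implybT.
by rewrite -mulrA ler_wpM2l ?powR_ge0 // mulrDr.
Qed.

(* Tangent line of the concave function [s |-> s ^ t] at [s = 1], obtained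
   from Young's inequality with exponents [t^-1] and [(1 - t)^-1]. *)
Lemma powR_le_tangent (s t : R) : 0 <= s -> 0 < t -> t < 1 ->
  s `^ t <= 1 + t * (s - 1).
Proof.
move=> s0 t0 t1; have u0 : 0 < 1 - t by rewrite subr_gt0.
have h := @conjugate_powR R (s `^ t) 1 t^-1 (1 - t)^-1.
have {h} : s `^ t * 1 <= (s `^ t) `^ t^-1 / t^-1 + 1 `^ (1 - t)^-1 / (1 - t)^-1.
  by apply: h; rewrite ?powR_ge0 ?invr_gt0 ?invrK // addrC subrK.
by rewrite mulr1 powRK ?gt_eqF // powR1 !invrK => h; apply: le_trans h _; lra.
Qed.

(** Jensen's inequality for a concave power: the tangent bound is used at each [u i] divided by the
    mean [w]. *)
Lemma sum_powR_le (I : finType) (D : {set I}) (u : I -> R) (t : R) :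
  0 < t -> t < 1 -> (forall i, 0 <= u i) ->
  \sum_(i in D) u i `^ t <= #|D|%:R `^ (1 - t) * (\sum_(i in D) u i) `^ t.
Proof.
move=> t0 t1 u0; have su0 : 0 <= \sum_(i in D) u i by exact: sumr_ge0.
have [z|nz] := eqVneq (\sum_(i in D) u i) 0.
  rewrite big1 ?mulr_ge0 ?powR_ge0 // => i iD.
  by rewrite (psumr_eq0P _ z) // powR0 // gt_eqF.
have sp : 0 < \sum_(i in D) u i by rewrite lt_def nz.
have Dp : 0 < #|D|%:R :> R.
  rewrite ltr0n card_gt0; apply: contra_neq nz => ->; exact: big_set0.
set N := #|D|%:R; set S := \sum_(i in D) u i; set w := S / N.
have wp : 0 < w by exact: divr_gt0.
(* The linear terms of the tangents cancel, since the ratios [u i / w] sum to [N]; what is left is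
   [N] times [w ^ t]. *)
have -> : N `^ (1 - t) * S `^ t = \sum_(i in D) w `^ t * (1 + t * (u i / w - 1)).
  rewrite -mulr_sumr big_split /= -mulr_sumr sumrB -mulr_suml sumr_const -/S -/N.
  have -> : S / w - N = 0.
    by rewrite /w invf_div mulrA mulrAC divff ?gt_eqF // mul1r subrr.
  rewrite mulr0 addr0 powRM ?invr_ge0 ?ltW // -/N.
  rewrite powRB; last by apply/implyP => _; rewrite gt_eqF.
  have -> : N^-1 `^ t = (N `^ t)^-1 by rewrite -powR_inv1 ?ltW // -powRrM mulN1r powRN.
  by rewrite powRr1 ?ltW // mulrC -mulrA [N / _]mulrC.
apply: ler_sum => i iD.
rewrite -[u i in X in X <= _](@divfK _ w) ?gt_eqF // mulrC powRM ?divr_ge0 ?(ltW wp) //.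
by rewrite ler_wpM2l ?powR_ge0 ?powR_le_tangent ?divr_ge0 ?(ltW wp).
Qed.

(** With [a], [b] the two norms, both nonzero, [(f + g)^2 <= (1 + b/a) f^2 + (1 + a/b) g^2] holds
    pointwise, the defect being [(b f - a g)^2 / (a b)]. Summing the right side gives exactly
    [(a + b)^2]. *)
Lemma minkowski_sqrt (I : finType) (f g : I -> R) :
  (forall i, 0 <= f i) -> (forall i, 0 <= g i) ->
  (\sum_i (f i + g i) `^ 2) `^ 2^-1
    <= (\sum_i f i `^ 2) `^ 2^-1 + (\sum_i g i `^ 2) `^ 2^-1.
Proof.
move=> f0 g0.
have two0 : 2 != 0 :> R by rewrite pnatr_eq0.
have s0 (h : I -> R) : 0 <= \sum_(i : I) h i `^ 2 by apply: sumr_ge0 => i _; exact: powR_ge0.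
set a := (\sum_i f i `^ 2) `^ 2^-1; set b := (\sum_i g i `^ 2) `^ 2^-1.
have a0 : 0 <= a by exact: powR_ge0.
have b0 : 0 <= b by exact: powR_ge0.
have ea : \sum_i f i `^ 2 = a ^+ 2 by rewrite -powR_mulrn // powRVK.
have eb : \sum_i g i `^ 2 = b ^+ 2 by rewrite -powR_mulrn // powRVK.
have da : a = (\sum_i f i `^ 2) `^ 2^-1 := erefl.
have db : b = (\sum_i g i `^ 2) `^ 2^-1 := erefl.
clearbody a b.
have zero (h : I -> R) : (forall i, 0 <= h i) -> \sum_(i : I) h i `^ 2 = 0 -> forall i, h i = 0.
  move=> h0 /psumr_eq0P hz i; have := hz (fun i _ => powR_ge0 _ _) i isT.
  exact: powR_eq0_eq0.
have [az|an] := eqVneq a 0.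
  rewrite (eq_bigr (fun i => g i `^ 2)) => [|i _]; first by rewrite -db lerDr.
  by rewrite (zero f) ?add0r // ea az expr0n.
have [bz|bn] := eqVneq b 0.
  rewrite (eq_bigr (fun i => f i `^ 2)) => [|i _]; first by rewrite -da lerDl.
  by rewrite (zero g) ?addr0 // eb bz expr0n.
have ap : 0 < a by rewrite lt_def an.
have bp : 0 < b by rewrite lt_def bn.
have le2 : \sum_i (f i + g i) `^ 2 <= (a + b) `^ 2.
  apply: (@le_trans _ _ (\sum_i ((1 + b / a) * f i `^ 2 + (1 + a / b) * g i `^ 2))).
    apply: ler_sum => i _; rewrite !powR_mulrn ?addr_ge0 //.
    rewrite -subr_ge0.
    have -> : (1 + b / a) * f i ^+ 2 + (1 + a / b) * g i ^+ 2 - (f i + g i) ^+ 2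
      = (b * f i - a * g i) ^+ 2 / (a * b) by field; rewrite an bn.
    by rewrite divr_ge0 ?sqr_ge0 ?mulr_ge0.
  rewrite big_split /= -!mulr_sumr ea eb powR_mulrn ?addr_ge0 //.
  by rewrite le_eqVlt; apply/orP; left; apply/eqP; field; rewrite an bn.
apply: le_trans (ler_powRl _ _ le2) _; rewrite ?invr_ge0 //.
by rewrite powRK // addr_ge0.
Qed.

End PowR.

(** * Choosing the largest entries of a finite family *)

Section Largest.
Variables (R : realType) (I : finType).
Implicit Types (f : I -> R) (B D T : {set I}).

Definition dominates f T B := forall i j, i \in T -> j \in B -> f j <= f i.

(** Greedy choice: an index maximal among those remaining is added at each step, until [D] is
    exhausted. *)
Lemma exists_largest f D (t : nat) : exists T,
  [/\ T \subset D, #|T| = minn t #|D| & dominates f T (D :\: T)].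
Proof.
elim: t => [|t [T [TD cT dT]]].
  by exists finset.set0; rewrite finset.sub0set cards0 min0n; split=> // i j; rewrite inE.
have [le_Dt|lt_tD] := leqP #|D| t.
  by exists T; split=> //; rewrite cT; lia.
have [i0 i0D] : exists i, i \in D :\: T.
  apply/finset.set0Pn; rewrite -card_gt0 cardsD (finset.setIidPr TD) cT; lia.
pose P := [pred i | i \in D :\: T].
have [/= i iDT imax] := @arg_maxP _ _ _ i0 P f i0D.
move: (iDT); rewrite inE => /andP[iT iD].
exists (i |: T); split.
- by rewrite finset.subUset finset.sub1set iD.
- rewrite cardsU1 iT cT; lia.
- move=> a b; rewrite !inE negb_or => /orP[/eqP ->|aT] /andP[/andP[bi bT] bD].
    by apply: imax; rewrite /P /= inE bT bD.
  by apply: dT; rewrite // inE bT bD.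
Qed.

Lemma dominates_threshold f T B : (forall i, 0 <= f i) -> dominates f T B ->
  exists2 M, 0 <= M & (forall i, i \in T -> M <= f i) /\
                      (forall j, j \in B -> f j <= M).
Proof.
(* The default value 0 of the maximum covers an empty [B]: it is still a lower bound on [T], as [f]
   is nonnegative. *)
move=> f0 dTB; exists (\big[Num.max/0]_(j in B) f j).
  exact: bigmax_ge_id.
split=> [i iT|j jB]; last exact: le_bigmax_cond.
by apply: bigmax_le => // j jB; exact: dTB.
Qed.

(** The sums differ only over [B :\: T] and [T :\: B]. The first set is no larger than the second,
    and a threshold [M] separates the values on them. *)
Lemma dominates_sum_le f T B : (forall i, 0 <= f i) -> (#|B| <= #|T|)%N ->
  dominates f T (B :\: T) -> \sum_(i in B) f i <= \sum_(i in T) f i.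
Proof.
move=> f0 BT /(dominates_threshold f0)[M M0 [MT MB]].
rewrite (big_setID T) [leRHS](big_setID B) /= finset.setIC lerD2l.
apply: (@le_trans _ _ (M *+ #|B :\: T|)).
  by rewrite -sumr_const ler_sum.
apply: (@le_trans _ _ (M *+ #|T :\: B|)).
  apply: ler_wpMn2l => //; rewrite !cardsD finset.setIC; lia.
rewrite -sumr_const; apply: ler_sum => i; rewrite inE => /andP[_]; exact: MT.
Qed.

End Largest.

(** * The modulus properties shared by the real and complex cases *)

Record is_modulus (R : realType) (F : nzRingType) (nrm : F -> R) : Prop := {
  modulus0 : nrm 0 = 0;
  modulus1 : nrm 1 = 1;
  modulus_ge0 : forall a, 0 <= nrm a;
  modulusN : forall a, nrm (- a) = nrm a;
  modulusM : forall a b, nrm (a * b) = nrm a * nrm b;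
  modulusD : forall a b, nrm (a + b) <= nrm a + nrm b }.

Lemma normr_is_modulus (R : realType) : is_modulus (fun a : R => `|a|).
Proof.
split; [exact: normr0|exact: normr1|exact: normr_ge0|exact: normrN|
  exact: normrM|exact: ler_normD].
Qed.

Lemma normc_is_modulus (R : realType) : is_modulus (@Normc.normc R).
Proof.
split; [exact: Normc.normc0|exact: Normc.normc1| |exact: normcN|
  exact: Normc.normcM|exact: le_normcD].
by case=> a b; exact: sqrtr_ge0.
Qed.

(** * Quasi-norms, restrictions to supports, tails, and distances up to a phase *)

Section Vectors.
Variables (R : realType) (F : nzRingType) (nrm : F -> R).
Hypothesis nrmP : is_modulus nrm.
Let nrm0 := modulus0 nrmP.
Let nrm1 := modulus1 nrmP.
Let nrm_ge0 := modulus_ge0 nrmP.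
Let nrmN := modulusN nrmP.
Let nrmM := modulusM nrmP.
Let nrmD := modulusD nrmP.
Local Notation "‖ u ‖_ q" := (qnorm nrm q u) (at level 0, q at level 0).

Lemma sum_modulus_ge0 (I : finType) (P : pred I) (g : I -> F) (q : R) :
  0 <= \sum_(i | P i) nrm (g i) `^ q.
Proof. by apply: sumr_ge0 => i _; exact: powR_ge0. Qed.

Lemma qnorm_ge0 (q : R) m (u : 'cV[F]_m) : 0 <= ‖u‖_q.
Proof. exact: powR_ge0. Qed.

Lemma qnormX (q : R) m (u : 'cV[F]_m) : q != 0 ->
  ‖u‖_q `^ q = \sum_i nrm (u i 0) `^ q.
Proof. by move=> q0; rewrite powRVK // sum_modulus_ge0. Qed.

Lemma qnorm0 (q : R) m : q != 0 -> ‖(0 : 'cV[F]_m)‖_q = 0.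
Proof.
move=> q0; rewrite /qnorm big1 ?powR0 ?invr_eq0 // => i _.
by rewrite mxE nrm0 powR0.
Qed.

Lemma qnormN (q : R) m (u : 'cV[F]_m) : ‖(- u)‖_q = ‖u‖_q.
Proof.
by rewrite /qnorm; congr (_ `^ _); apply: eq_bigr => i _; rewrite mxE nrmN.
Qed.

Lemma qnorm2D m (u v : 'cV[F]_m) : ‖(u + v)‖_2 <= ‖u‖_2 + ‖v‖_2.
Proof.
apply: (le_trans _ (minkowski_sqrt (fun i => nrm_ge0 (u i 0))
  (fun i => nrm_ge0 (v i 0)))).
apply: ler_powRl; rewrite ?invr_ge0 ?sum_modulus_ge0 //.
by apply: ler_sum => i _; apply: ler_powRl; rewrite // mxE.
Qed.

Definition restr n (D : {set 'I_n}) (v : 'cV[F]_n) : 'cV[F]_n :=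
  \col_i (if i \in D then v i 0 else 0).

Lemma restr_id n (v : 'cV[F]_n) (D : {set 'I_n}) :
  v = restr D v + restr (~: D) v.
Proof.
apply/matrixP => i j; rewrite (ord1 j) !mxE inE.
by case: (i \in D); rewrite ?addr0 ?add0r.
Qed.

Lemma restr_setD n (T D : {set 'I_n}) (v : 'cV[F]_n) : T \subset D ->
  restr D v = restr T v + restr (D :\: T) v.
Proof.
move=> TD; apply/matrixP => i j; rewrite !mxE inE.
by have [iT|] := boolP (i \in T); rewrite /= ?add0r // (fintype.subsetP TD) ?addr0.
Qed.

Lemma restr_set0 n (v : 'cV[F]_n) : restr finset.set0 v = 0.
Proof. by apply/matrixP => i j; rewrite !mxE inE. Qed.

Lemma l0_restr n (D : {set 'I_n}) (v : 'cV[F]_n) : (l0 (restr D v) <= #|D|)%N.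
Proof.
apply: subset_leq_card; apply/fintype.subsetP => i; rewrite inE /= mxE.
by case: (i \in D); rewrite ?eqxx.
Qed.

Lemma qnorm_restr (q : R) n (D : {set 'I_n}) (v : 'cV[F]_n) : q != 0 ->
  ‖(restr D v)‖_q = (\sum_(i in D) nrm (v i 0) `^ q) `^ q^-1.
Proof.
move=> q0; rewrite /qnorm [in RHS]big_mkcond /=; congr (_ `^ _).
by apply: eq_bigr => i _; rewrite mxE; case: (i \in D); rewrite // nrm0 powR0.
Qed.

Lemma qnorm_restrS (q : R) n (D E : {set 'I_n}) (v : 'cV[F]_n) : 0 < q ->
  D \subset E -> ‖(restr D v)‖_q <= ‖(restr E v)‖_q.
Proof.
move=> q0 DE; rewrite !qnorm_restr ?gt_eqF //.
apply: ler_powRl; rewrite ?invr_ge0 ?(ltW q0) ?sum_modulus_ge0 //.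
rewrite [leRHS](big_setID D) /= (finset.setIidPr DE) lerDl; exact: sum_modulus_ge0.
Qed.

(** The [p]-th powers add over disjoint supports, and the exponent [p^-1 >= 1] is superadditive. *)
Lemma qnorm_restr_superadditive (p : R) n (T D : {set 'I_n}) (v : 'cV[F]_n) :
  0 < p -> p <= 1 -> T \subset D ->
  ‖(restr T v)‖_p + ‖(restr (D :\: T) v)‖_p <= ‖(restr D v)‖_p.
Proof.
move=> p0 p1 TD; rewrite !qnorm_restr ?gt_eqF //.
rewrite [in leRHS](big_setID T) /= (finset.setIidPr TD).
by apply: powR_superadditive; rewrite ?sum_modulus_ge0 // invf_ge1.
Qed.

(** Both sides are compared with a vector of [#|T|] entries equal to a separating threshold [M]: its
    l2-norm is [#|T|^(1/2) M], its lp-quasinorm [#|T|^(1/p) M]. *)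
Lemma qnorm2_restr_le_dominated (p : R) n (T B : {set 'I_n}) (v : 'cV[F]_n) :
  0 < p -> (0 < #|T|)%N -> (#|B| <= #|T|)%N ->
  dominates (fun i => nrm (v i 0)) T B ->
  ‖(restr B v)‖_2 <= #|T|%:R `^ (- (p^-1 - 2^-1)) * ‖(restr T v)‖_p.
Proof.
move=> p0 T0 BT /dominates_threshold[] // M M0 [MT MB].
have two0 : 2 != 0 :> R by rewrite pnatr_eq0.
rewrite !qnorm_restr ?gt_eqF //.
have tp : 0 < #|T|%:R :> R by rewrite ltr0n.
apply: (@le_trans _ _ ((#|T|%:R * M `^ 2) `^ 2^-1)).
  apply: ler_powRl; rewrite ?invr_ge0 ?sum_modulus_ge0 //.
  apply: (@le_trans _ _ (\sum_(i in B) M `^ 2)).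
    by apply: ler_sum => i iB; apply: ler_powRl => //; exact: MB.
  rewrite sumr_const -[leLHS]mulr_natl ler_wpM2r ?powR_ge0 // ler_nat //.
have -> : (#|T|%:R * M `^ 2) `^ 2^-1
    = #|T|%:R `^ (- (p^-1 - 2^-1)) * (#|T|%:R * M `^ p) `^ p^-1.
  rewrite !powRM ?powR_ge0 ?ler0n // !powRK ?gt_eqF // mulrA -powRD.
    by congr (_ `^ _ * _); ring.
  by apply/implyP => _; rewrite gt_eqF.
rewrite ler_wpM2l ?powR_ge0 //; apply: ler_powRl.
- by rewrite invr_ge0 ltW.
- by rewrite mulr_ge0 ?powR_ge0.
- rewrite mulr_natl -sumr_const; apply: ler_sum => i iT.
  by apply: ler_powRl => //; [exact: ltW|exact: MT].
Qed.

(* Cutting [D :\: T] into blocks of [t] entries in decreasing order, the l2-norm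
   of each block is controlled by the lp-quasinorm of the preceding one. *)
Lemma block_tail_le (p : R) n (t : nat) (N : 'cV[F]_n -> R) (c : R) (v : 'cV[F]_n) :
  0 < p -> p <= 1 -> (0 < t)%N -> 0 <= c ->
  (forall u w, N (u + w) <= N u + N w) ->
  (forall u, (l0 u <= t)%N -> N u <= c * ‖u‖_2) ->
  forall D T : {set 'I_n}, T \subset D -> #|T| = minn t #|D| ->
  dominates (fun i => nrm (v i 0)) T (D :\: T) ->
  N (restr (D :\: T) v)
    <= c * (t%:R `^ (- (p^-1 - 2^-1)) * ‖(restr D v)‖_p).
Proof.
move=> p0 p1 t0 c0 ND Nsp D.
have [s] := ubnP #|D|; elim: s D => // s IH D /ltnSE Ds T TD cT dT.
have q0 : 0 <= t%:R `^ (- (p^-1 - 2^-1)) :> R by exact: powR_ge0.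
have [le_Dt|lt_tD] := leqP #|D| t.
  have -> : D :\: T = finset.set0.
    by apply/eqP; rewrite -cards_eq0 cardsD (finset.setIidPr TD) cT; lia.
  have h0 : (l0 (restr finset.set0 v) <= t)%N.
    by apply: leq_trans (l0_restr _ _) _; rewrite cards0.
  apply: le_trans (Nsp _ h0) _.
  rewrite restr_set0 qnorm0 ?pnatr_eq0 // mulr0.
  by rewrite mulr_ge0 ?mulr_ge0 ?qnorm_ge0.
have {}cT : #|T| = t by rewrite cT; lia.
have Tt0 : (0 < #|T|)%N by rewrite cT.
set D' := D :\: T.
have [T' [TD' cT' dT']] := exists_largest (fun i => nrm (v i 0)) D' t.
have cD' : (#|D'| < #|D|)%N by rewrite cardsD (finset.setIidPr TD) cT; lia.
rewrite (restr_setD _ TD').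
apply: le_trans (ND _ _) _.
apply: le_trans (lerD (Nsp _ _) (IH D' _ T' TD' cT' dT')) _.
- by apply: leq_trans (l0_restr _ _) _; rewrite cT'; lia.
- exact: leq_trans cD' Ds.
rewrite -mulrDr ler_wpM2l //.
(* The block [T'] is charged to [T] and the later blocks to [D']. Superadditivity merges both
   charges into the quasinorm on [D], so the constant does not grow along the induction. *)
apply: (@le_trans _ _ (t%:R `^ (- (p^-1 - 2^-1)) *
  (‖(restr T v)‖_p + ‖(restr D' v)‖_p))); last first.
  by rewrite ler_wpM2l // qnorm_restr_superadditive.
rewrite mulrDr lerD2r -cT; apply: qnorm2_restr_le_dominated => //.
  by rewrite cT' cT; lia.
by move=> i j iT jT'; apply: dT; rewrite // (fintype.subsetP TD').
Qed.

Lemma lbound_qnorms (q : R) n (x y : 'cV[F]_n) : has_lbound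
  ([set qnorm nrm q (x - c *: y) | c in [set c : F | nrm c = 1]])%classic.
Proof. by exists 0 => _ [c _ <-]; exact: qnorm_ge0. Qed.

Lemma distq_le (q : R) n (x y : 'cV[F]_n) c : nrm c = 1 ->
  distq nrm q x y <= ‖(x - c *: y)‖_q.
Proof. by move=> c1; apply: ge_inf; [exact: lbound_qnorms|exists c]. Qed.

Lemma le_distq (q : R) n (x y : 'cV[F]_n) b :
  (forall c, nrm c = 1 -> b <= ‖(x - c *: y)‖_q) -> b <= distq nrm q x y.
Proof.
move=> h; apply: lb_le_inf; first by exists ‖(x - 1 *: y)‖_q; exists 1.
by move=> _ [c c1 <-]; exact: h.
Qed.

Lemma distq_ge0 (q : R) n (x y : 'cV[F]_n) : 0 <= distq nrm q x y.
Proof. by apply: le_distq => c _; exact: qnorm_ge0. Qed.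

Lemma distq0 (q : R) n (x : 'cV[F]_n) : distq nrm q x 0 = ‖x‖_q.
Proof.
apply/le_anti/andP; split.
  by have := @distq_le q n x 0 1 nrm1; rewrite scaler0 subr0.
by apply: le_distq => c _; rewrite scaler0 subr0.
Qed.

Lemma l0_0 n : l0 (0 : 'cV[F]_n) = 0%N.
Proof.
by rewrite /l0 eq_card0 // => i; apply/negbTE/negP => /set_mem /=; rewrite mxE eqxx.
Qed.

(** Outside the support [B] of a competitor [z], the residual [x - c *: z] equals [x]. Hence its
    error is at least the tail of [x] off [B], and replacing [B] by the largest entries [S] only
    decreases that tail. *)
Lemma qnorm_restr_le_sigmak (p : R) n k (x : 'cV[F]_n) (S : {set 'I_n}) :
  0 < p -> #|S| = k -> dominates (fun i => nrm (x i 0)) S (~: S) ->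
  ‖(restr (~: S) x)‖_p <= sigmak nrm k p x.
Proof.
move=> p0 cS dS; have pn0 : p != 0 by rewrite gt_eqF.
apply: lb_le_inf.
  exists (distq nrm p x 0); exists 0 => //=.
  by rewrite l0_0.
move=> _ [z zk <-]; apply: le_distq => c _.
rewrite [leLHS](qnorm_restr _ _ pn0).
apply: ler_powRl; rewrite ?invr_ge0 ?(ltW p0) ?sum_modulus_ge0 //.
(* [l0] counts a classical set; [B] is the same support as a finite set. *)
pose B : {set 'I_n} := [set i | z i 0 != 0]%SET.
have cB : (#|B| <= #|S|)%N.
  rewrite cS; apply: leq_trans zk; apply: eq_leq; apply: eq_card => i.
  by rewrite [LHS]finset.inE; apply/idP/idP => [h|/set_mem //]; exact: mem_set.
apply: (@le_trans _ _ (\sum_(i in ~: B) nrm (x i 0) `^ p)); last first.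
  rewrite [leRHS](bigID (mem B)) /= addrC.
  apply: ler_wpDr; first exact: sum_modulus_ge0.
  rewrite le_eqVlt; apply/orP; left; apply/eqP.
  apply: eq_big => [i|i]; rewrite ?inE // negbK => /eqP zi.
  by rewrite !mxE zi mulr0 subr0.
have := @dominates_sum_le _ _ (fun i => nrm (x i 0) `^ p) S B.
have tot (E : {set 'I_n}) : \sum_(i in ~: E) nrm (x i 0) `^ p
    = \sum_i nrm (x i 0) `^ p - \sum_(i in E) nrm (x i 0) `^ p.
  rewrite [X in _ = X - _](bigID (mem E)) /= addrAC subrr add0r.
  by apply: eq_bigl => i; rewrite inE.
rewrite !tot lerD2l lerN2; apply => // [i|i j iS].
  exact: powR_ge0.
rewrite inE => /andP[jS _]; apply: ler_powRl; rewrite ?(ltW p0) //.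
by apply: dS; rewrite // inE.
Qed.

(** Concavity of the power [p / 2 < 1], applied to the squared moduli. *)
Lemma sum_powR_restr_le (p : R) n k (S : {set 'I_n}) (u : 'cV[F]_n) :
  0 < p -> p <= 1 -> #|S| = k ->
  \sum_(i in S) nrm (u i 0) `^ p <= k%:R `^ (1 - p / 2) * ‖u‖_2 `^ p.
Proof.
move=> p0 p1 cS.
have two0 : 2 != 0 :> R by rewrite pnatr_eq0.
have t0 : 0 < p / 2 by rewrite divr_gt0.
have t1 : p / 2 < 1 by lra.
have := @sum_powR_le R _ S (fun i => nrm (u i 0) `^ 2) _ t0 t1
  (fun i => powR_ge0 _ _).
rewrite cS (eq_bigr (fun i => nrm (u i 0) `^ p)); last first.
  by move=> i _; rewrite -powRrM mulrCA divff // mulr1.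
move=> h; apply: le_trans h _; rewrite ler_wpM2l ?powR_ge0 //.
rewrite /qnorm -powRrM [2^-1 * p]mulrC; apply: ler_powRl; rewrite ?(ltW t0) ?sum_modulus_ge0 //.
rewrite [leRHS](bigID (mem S)) /= lerDl; exact: sum_modulus_ge0.
Qed.

(** Both quasinorms are split along [S]. On [S], the modulus of [x] is that of [c *: x], so
    subadditivity bounds its power by those of [z - c *: x] and [z]; the part of [z] on [S] then
    cancels. *)
Lemma cone_le (p : R) n (S : {set 'I_n}) (x z : 'cV[F]_n) c :
  0 < p -> p <= 1 -> nrm c = 1 -> ‖z‖_p <= ‖x‖_p ->
  \sum_(i in ~: S) nrm (z i 0) `^ p <=
    \sum_(i in S) nrm ((z - c *: x) i 0) `^ p + \sum_(i in ~: S) nrm (x i 0) `^ p.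
Proof.
move=> p0 p1 c1 zx; have pn0 : p != 0 by rewrite gt_eqF.
have h0 : ‖z‖_p `^ p <= ‖x‖_p `^ p by exact: ler_powRl (ltW p0) (qnorm_ge0 _ _) zx.
rewrite [leLHS](qnormX z pn0) [leRHS](qnormX x pn0) in h0.
move: h0; rewrite (bigID (mem S)) [leRHS](bigID (mem S)) /=.
have eC (y : 'cV[F]_n) : \sum_(i | i \notin S) nrm (y i 0) `^ p
    = \sum_(i in ~: S) nrm (y i 0) `^ p by apply: eq_bigl => i; rewrite inE.
rewrite !eC => h.
have g : \sum_(i in S) nrm (x i 0) `^ p <=
    \sum_(i in S) nrm ((z - c *: x) i 0) `^ p + \sum_(i in S) nrm (z i 0) `^ p.
  rewrite -big_split /=; apply: ler_sum => i _.
  apply: le_trans (powR_subadditive p0 p1 _ _) => //.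
  apply: ler_powRl; rewrite ?(ltW p0) //.
  have -> : nrm (x i 0) = nrm (- (z - c *: x) i 0 + z i 0).
    by rewrite !mxE opprB subrK nrmM c1 mul1r.
  by rewrite -[X in _ <= X + _]nrmN nrmD.
rewrite -(lerD2l (\sum_(i in S) nrm (z i 0) `^ p)); apply: (le_trans h).
by rewrite addrA [X in _ <= X + _]addrC lerD2r; exact: g.
Qed.

End Vectors.

(** * Consequences of the Lipschitz bounds and of minimality *)

Section Recovery.
Variables (R : realType) (F : nzRingType) (nrm : F -> R).
Hypothesis nrmP : is_modulus nrm.
Local Notation "‖ u ‖_ q" := (qnorm nrm q u) (at level 0, q at level 0).

(** Solved for the norm, which is possible as [s > 0], the hypothesis is a lower bound valid for
    every phase, hence for the infimum. *)
Lemma le_distq_affine (q : R) n (x y : 'cV[F]_n) (b s w : R) : 0 < s ->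
  (forall c, nrm c = 1 -> b <= s * ‖(x - c *: y)‖_q + w) ->
  b <= s * distq nrm q x y + w.
Proof.
move=> s0 h; rewrite -lerBlDr mulrC -ler_pdivrMr //.
apply: (le_distq nrmP) => c c1; rewrite ler_pdivrMr // mulrC lerBlDr; exact: h.
Qed.

Lemma le_distq_powR (q p : R) n (x y : 'cV[F]_n) (b s w : R) : 0 < p -> 0 < s ->
  (forall c, nrm c = 1 -> b <= s * ‖(x - c *: y)‖_q `^ p + w) ->
  b <= s * distq nrm q x y `^ p + w.
Proof.
move=> p0 s0 h.
(* The [p]-th root of [(b - w) / s] serves as lower bound for the norms only when [b - w] is
   nonnegative. *)
have [le_bw|lt_wb] := leP b w.
  by rewrite (le_trans le_bw) // lerDr mulr_ge0 ?powR_ge0 ?(ltW s0).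
rewrite -lerBlDr mulrC -ler_pdivrMr //.
have g0 : 0 <= (b - w) / s by rewrite divr_ge0 ?subr_ge0 ?(ltW lt_wb) ?(ltW s0).
rewrite -[leLHS](@powRVK _ _ p) ?gt_eqF //.
apply: ler_powRl; rewrite ?powR_ge0 ?(ltW p0) //.
apply: (le_distq nrmP) => c c1.
rewrite -[leRHS](@powRK _ _ p) ?qnorm_ge0 ?gt_eqF //.
apply: ler_powRl; rewrite ?invr_ge0 ?(ltW p0) //.
rewrite ler_pdivrMr // mulrC lerBlDr; exact: h.
Qed.

Lemma rnorm2D m (u v : 'cV[R]_m) : rnorm2 (u + v) <= rnorm2 u + rnorm2 v.
Proof. exact: (qnorm2D (normr_is_modulus R)). Qed.

Lemma rnorm2N m (u : 'cV[R]_m) : rnorm2 (- u) = rnorm2 u.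
Proof. exact: (qnormN (normr_is_modulus R)). Qed.

Lemma rnorm2_absvB m (u v : 'cV[F]_m) :
  rnorm2 (absv nrm u - absv nrm v) <= ‖(u - v)‖_2.
Proof.
apply: ler_powRl; rewrite ?invr_ge0 //.
  by apply: sumr_ge0 => i _; exact: powR_ge0.
apply: ler_sum => i _; apply: ler_powRl => //; rewrite !mxE ler_norml.
have h1 := modulusD nrmP (u i 0 - v i 0) (v i 0).
have h2 := modulusD nrmP (v i 0 - u i 0) (u i 0).
move: h1 h2; rewrite !subrK -[v i 0 - _]opprB (modulusN nrmP) => h1 h2.
by apply/andP; split; lra.
Qed.

Lemma absv0 m : absv nrm (0 : 'cV[F]_m) = 0.
Proof. by apply/matrixP => i j; rewrite !mxE (modulus0 nrmP). Qed.

Lemma rnorm2_absv m (u : 'cV[F]_m) : rnorm2 (absv nrm u) = ‖u‖_2.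
Proof.
congr (_ `^ _); apply: eq_bigr => i _.
by rewrite mxE ger0_norm // (modulus_ge0 nrmP).
Qed.

(** Comparison with 0, where the phaseless distance is the norm, turns the upper Lipschitz bound
    into an ordinary bound for [A]. *)
Lemma biLip_upper m n (A : 'M[F]_(m, n)) (X : set 'cV[F]_n) L U u :
  phaseless_biLip nrm A X L U -> X 0 -> X u -> ‖(A *m u)‖_2 <= U * ‖u‖_2.
Proof.
move=> bl X0 Xu; have [_] := bl _ _ Xu X0.
by rewrite mulmx0 absv0 subr0 rnorm2_absv (distq0 nrmP).
Qed.

Lemma biLip_const_le m n (A : 'M[F]_(m, n)) (X : set 'cV[F]_n) L U u :
  phaseless_biLip nrm A X L U -> X 0 -> X u -> 0 < ‖u‖_2 -> L <= U.
Proof.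
move=> bl X0 Xu u0; have [h1 h2] := bl _ _ Xu X0.
by move: (le_trans h1 h2); rewrite (distq0 nrmP) ler_pM2r.
Qed.

(** The subadditive [N] is abstract so that the same supports serve both for the l2-norm and for the
    l2-norm of the image under [A]. *)
Lemma exists_block_supports (p : R) n k t (x z : 'cV[F]_n) :
  0 < p -> p <= 1 -> (0 < k <= n)%N -> (0 < t)%N ->
  exists S T0 T : {set 'I_n},
  [/\ [/\ #|S| = k, S \subset T0 & T0 \subset T],
      (#|T0| <= k + k)%N /\ (#|T| <= k + k + t)%N,
      ‖(restr (~: S) x)‖_p <= sigmak nrm k p x &
      forall (N : 'cV[F]_n -> R) (c : R), 0 <= c ->
        (forall u w, N (u + w) <= N u + N w) ->
        (forall u, (l0 u <= k + t)%N -> N u <= c * ‖u‖_2) ->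
        N (restr (~: T0) x)
          <= c * (k%:R `^ (- (p^-1 - 2^-1)) * sigmak nrm k p x) /\
        N (restr (~: T) z)
          <= c * (t%:R `^ (- (p^-1 - 2^-1)) * ‖(restr (~: S) z)‖_p)].
Proof.
move=> p0 p1 /andP[k0 kn] t0.
have [S [_ cS dS]] := exists_largest (fun i => nrm (x i 0)) [set: 'I_n]%SET k.
rewrite cardsT card_ord (minn_idPl kn) finset.setTD in cS dS.
have [S1 [S1S cS1 dS1]] := exists_largest (fun i => nrm (x i 0)) (~: S) k.
set T0 := S :|: S1.
have [T1 [T1T0 cT1 dT1]] := exists_largest (fun i => nrm (z i 0)) (~: T0) t.
set T := T0 :|: T1.
have sigS := qnorm_restr_le_sigmak nrmP p0 cS dS.
have eT0 : ~: T0 = ~: S :\: S1 by rewrite finset.setDE finset.setCU.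
have eT : ~: T = ~: T0 :\: T1 by rewrite finset.setDE finset.setCU.
have cT0 : (#|T0| <= k + k)%N.
  by rewrite (leq_trans (leq_card_setU _ _)) // cS cS1 leq_add2l geq_minl.
exists S, T0, T; split => //.
- by split=> //; exact: finset.subsetUl.
- split=> //; rewrite (leq_trans (leq_card_setU _ _)) // leq_add //.
  by rewrite cT1 geq_minl.
move=> N c c0 ND Nc; split.
  rewrite eT0; apply: le_trans (block_tail_le nrmP p0 p1 k0 c0 ND _ S1S cS1 dS1) _.
    by move=> u uk; apply: Nc; rewrite (leq_trans uk) // leq_addr.
  by apply: (ler_wpM2l c0); apply: (ler_wpM2l (powR_ge0 _ _)); exact: sigS.
rewrite eT; apply: le_trans (block_tail_le nrmP p0 p1 t0 c0 ND _ T1T0 cT1 dT1) _.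
  by move=> u uk; apply: Nc; rewrite (leq_trans uk) // leq_addl.
apply: (ler_wpM2l c0); apply: (ler_wpM2l (powR_ge0 _ _)).
by apply: (qnorm_restrS nrmP _ p0); rewrite finset.setCS finset.subsetUl.
Qed.

(** * Estimates for one fixed unimodular scalar *)

Section FixedPhase.
Variables (p s : R) (n k : nat) (x z : 'cV[F]_n) (S T0 T : {set 'I_n}) (c : F).
Hypotheses (p0 : 0 < p) (p1 : p <= 1) (c1 : nrm c = 1) (s0 : 0 <= s).
Hypotheses (cS : #|S| = k) (ST0 : S \subset T0) (T0T : T0 \subset T).
Hypotheses (zx : ‖z‖_p <= ‖x‖_p) (xs : ‖(restr (~: S) x)‖_p <= s).

Let head := ‖(restr T z - c *: restr T0 x)‖_2.

Let pn0 : p != 0. Proof. by rewrite gt_eqF. Qed.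

Let x_tail_le : \sum_(i in ~: S) nrm (x i 0) `^ p <= s `^ p.
Proof.
rewrite -[leLHS](@powRVK _ _ p) ?sum_modulus_ge0 // -(qnorm_restr nrmP) //.
by apply: ler_powRl; rewrite ?qnorm_ge0 // ltW.
Qed.

Let head_le :
  \sum_(i in S) nrm ((z - c *: x) i 0) `^ p <= k%:R `^ (1 - p / 2) * head `^ p.
Proof.
apply: (le_trans _ (sum_powR_restr_le nrm (restr T z - c *: restr T0 x) p0 p1 cS)).
rewrite le_eqVlt; apply/orP; left; apply/eqP; apply: eq_bigr => i iS.
have iT0 := fintype.subsetP ST0 _ iS; have iT := fintype.subsetP T0T _ iT0.
by rewrite !mxE iT0 iT.
Qed.

Let z_tail_le : \sum_(i in ~: S) nrm (z i 0) `^ p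
  <= k%:R `^ (1 - p / 2) * head `^ p + s `^ p.
Proof.
apply: le_trans (cone_le nrmP S p0 p1 c1 zx) _; exact: lerD.
Qed.

(** The root of order [p] of the cone inequality, where [(1 - p/2) / p = 1/p - 1/2]. *)
Lemma qnorm_tail_le : ‖(restr (~: S) z)‖_p
  <= 2 `^ (p^-1 - 1) * (k%:R `^ (p^-1 - 2^-1) * head + s).
Proof.
rewrite (qnorm_restr nrmP) //.
apply: le_trans (ler_powRl _ _ z_tail_le) _; rewrite ?invr_ge0 ?(ltW p0) //.
  exact: sum_modulus_ge0.
apply: le_trans (powRD_le_convex _ _ _) _; rewrite ?mulr_ge0 ?powR_ge0 //.
  by rewrite invf_ge1.
rewrite ler_wpM2l ?powR_ge0 // powRM ?powR_ge0 // !powRK ?qnorm_ge0 //.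
rewrite -powRrM.
suff -> : (1 - p / 2) * p^-1 = p^-1 - 2^-1 by [].
by field; rewrite pn0.
Qed.

(** The head enters twice: directly on [S], and through the tail of [z]. So does [s]: through the
    tail of [z] and that of [x]. *)
Lemma qnorm_powR_le : ‖(z - c *: x)‖_p `^ p
  <= 2 * k%:R `^ (1 - p / 2) * head `^ p + 2 * s `^ p.
Proof.
rewrite [leLHS](qnormX nrm (z - c *: x) pn0) [leLHS](bigID (mem S)) /=.
have tail : \sum_(i | i \notin S) nrm ((z - c *: x) i 0) `^ p
    <= \sum_(i in ~: S) nrm (z i 0) `^ p + \sum_(i in ~: S) nrm (x i 0) `^ p.
  rewrite -big_split /= [leRHS](eq_bigl (fun i => i \notin S)); last first.
    by move=> i; rewrite inE.
  apply: ler_sum => i _.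
  apply: le_trans (powR_subadditive p0 p1 _ _); rewrite ?(modulus_ge0 nrmP) //.
  apply: ler_powRl; rewrite ?(modulus_ge0 nrmP) ?(ltW p0) // !mxE.
  apply: le_trans (modulusD nrmP _ _) _.
  by rewrite (modulusN nrmP) (modulusM nrmP) c1 mul1r.
move: tail head_le z_tail_le x_tail_le; lra.
Qed.

End FixedPhase.

(** Since [2 + r >= 4], the power is at least [2 ^ (2 - p)], and [2 - p >= 1]. *)
Lemma ge2_powR (r p : R) : p <= 1 -> 2 <= r -> 2 <= (2 + r) `^ (1 - p / 2).
Proof.
move=> p1 r2; apply: (@le_trans _ _ (4 `^ (1 - p / 2))); last first.
  by apply: ler_powRl; lra.
have -> : 4 = 2 `^ 2 :> R by rewrite powR_mulrn // expr2 -natrM.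
rewrite -powRrM; apply: (@le_trans _ _ (2 `^ 1)); first by rewrite powRr1.
by apply: ler_powR; lra.
Qed.

End Recovery.

(** * Arithmetic of the explicit constants *)

Section ExplicitConstants.
Variables (R : realType) (U L r p : R).
Hypotheses (p0 : 0 < p) (p1 : p <= 1) (r0 : 0 < r) (U0 : 0 < U).
Hypothesis den0 : 0 < denom U L r p.

Let a : R := p^-1 - 2^-1.

Lemma exponent_gt0 : 0 < p^-1 - 2^-1.
Proof.
have : 1 <= p^-1 by rewrite invf_ge1.
by move=> h; lra.
Qed.

Lemma powR_div2_opp : (r / 2) `^ (- a) = (2 / r) `^ a.
Proof.
rewrite -mulN1r powRrM powR_inv1 ?divr_ge0 ?(ltW r0) //.
by rewrite invf_div.
Qed.

(** The estimates produce [r ^ (- a)], whereas [denom] carries the larger [(2 / r) ^ a]; this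
    comparison bridges the two. *)
Lemma powR_opp_le : r `^ (- a) <= (2 / r) `^ a.
Proof.
have -> : r `^ (- a) = r^-1 `^ a by rewrite -mulN1r powRrM powR_inv1 // ltW.
apply: ler_powRl; rewrite ?(ltW exponent_gt0) ?invr_ge0 ?(ltW r0) //.
by rewrite ler_peMl ?invr_ge0 ?(ltW r0) // ler1n.
Qed.

Lemma Ct2_ge0 : 0 <= Ct2 U L r p.
Proof.
by rewrite /Ct2 divr_ge0 ?(ltW den0) // mulr_ge0 ?(ltW U0) // addr_ge0 // mulr_ge0 ?powR_ge0.
Qed.

Lemma Dt2_ge0 : 0 <= Dt2 U L r p.
Proof. by rewrite /Dt2 divr_ge0 // ltW. Qed.

(** If [r < 2], both powers in [denom] are at least 1, so the subtracted term is at least [U >= L],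
    against positivity. *)
Lemma ratio_ge2 : L <= U -> 2 <= r.
Proof.
move=> LU; rewrite leNgt; apply/negP => r2.
have h1 : 1 <= 2 `^ (p^-1 - 1) :> R.
  by rewrite -[leLHS](powRr0 2); apply: ler_powR; rewrite ?ler1n // subr_ge0 invf_ge1.
have h2 : 1 <= (2 / r) `^ a.
  rewrite -[leLHS](congr1 (fun f => f a) (powR1 R)).
  apply: ler_powRl; rewrite ?(ltW exponent_gt0) //.
  by rewrite ler_pdivlMr // mul1r ltW.
move: den0; rewrite /denom ltNge -mulrA; apply/negP/negPn.
rewrite subr_le0 (le_trans LU) // -[leLHS]mulr1 ler_pM2l //.
by rewrite -[leLHS]mulr1 ler_pM.
Qed.

Lemma head_bound (d tau eta : R) : 0 <= d ->
  L * d <= U * (2 `^ (p^-1 - 1) * r `^ (- a)) * d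
    + (2 * eta + U * (2 `^ (p^-1 - 1) * r `^ (- a) + 1) * tau) ->
  d <= Ct2 U L r p * tau + Dt2 U L r p * eta.
Proof.
move=> d0 hd.
have -> : Ct2 U L r p * tau + Dt2 U L r p * eta =
   (2 * eta + U * (2 `^ (p^-1 - 1) * r `^ (- a) + 1) * tau) / denom U L r p.
  by rewrite /Ct2 /Dt2 -/a; field; rewrite gt_eqF.
rewrite ler_pdivlMr //; apply: (@le_trans _ _
   (d * (L - U * (2 `^ (p^-1 - 1) * r `^ (- a))))); last by move: hd; lra.
rewrite ler_wpM2l // lerD2l lerN2 -mulrA ler_pM2l //.
by rewrite ler_wpM2l ?powR_ge0 // powR_opp_le.
Qed.

(** Only the coefficient of [d] is enlarged from [r ^ (- a)] to [(r / 2) ^ (- a)]; the separate term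
    in [tau] keeps [r ^ (- a)], as in [C2]. *)
Lemma final_bound2 (D d tau eta : R) : 0 <= d ->
  D <= (1 + 2 `^ (p^-1 - 1) * r `^ (- a)) * d
       + (2 `^ (p^-1 - 1) * r `^ (- a) + 1) * tau ->
  d <= Ct2 U L r p * tau + Dt2 U L r p * eta ->
  D <= C2 U L r p * tau + D2 U L r p * eta.
Proof.
move=> d0 hD hd; apply: (le_trans hD); rewrite /C2 /D2 -/a powR_div2_opp.
set h := 2 `^ _ in hD *.
have hge0 : 0 <= h by exact: powR_ge0.
have g : (1 + h * r `^ (- a)) * d <=
    (1 + h * (2 / r) `^ a) * (Ct2 U L r p * tau + Dt2 U L r p * eta).
  apply: ler_pM => //; first by rewrite addr_ge0 // mulr_ge0 ?powR_ge0.
  by rewrite lerD2l ler_wpM2l // powR_opp_le.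
apply: (le_trans (lerD g (lexx _))).
by rewrite le_eqVlt; apply/orP; left; apply/eqP; ring.
Qed.

Lemma final_bound1 (D d s kap eta : R) :
  0 <= D -> 0 <= d -> 0 <= s -> 0 < kap -> 0 <= eta -> L <= U ->
  D `^ p <= 2 * kap `^ p * d `^ p + 2 * s `^ p ->
  d <= Ct2 U L r p * (s / kap) + Dt2 U L r p * eta ->
  D <= C1 U L r p * s + D1 U L r p * kap * eta.
Proof.
move=> D0 d0 s0 kap0 eta0 LU hD hd.
have pn0 : p != 0 by rewrite gt_eqF.
have C0 := Ct2_ge0; have Dt0 := Dt2_ge0.
have g2 := @ge2_powR R r p p1 (ratio_ge2 LU).
have skap0 : 0 <= s / kap by rewrite divr_ge0 // ltW.
have hdp : kap `^ p * d `^ p <=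
    Ct2 U L r p `^ p * s `^ p + Dt2 U L r p `^ p * (kap `^ p * eta `^ p).
  have hp : d `^ p <= (Ct2 U L r p * (s / kap)) `^ p + (Dt2 U L r p * eta) `^ p.
    apply: (le_trans _ (powR_subadditive p0 p1 (mulr_ge0 C0 skap0) (mulr_ge0 Dt0 eta0))).
    by apply: ler_powRl; rewrite ?(ltW p0).
  apply: le_trans (ler_wpM2l (powR_ge0 _ _) hp) _.
  have -> : s `^ p = (s / kap) `^ p * kap `^ p.
    by rewrite -powRM ?(ltW kap0) // divfK // gt_eqF.
  rewrite (powRM p C0 skap0) (powRM p Dt0 eta0).
  by rewrite le_eqVlt; apply/orP; left; apply/eqP; ring.
have X0 : 0 <= Ct2 U L r p `^ p * s `^ p by rewrite mulr_ge0 ?powR_ge0.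
have Y0 : 0 <= Dt2 U L r p `^ p * (kap `^ p * eta `^ p).
  by rewrite !mulr_ge0 ?powR_ge0.
have Ct1_ge0 : 0 <= Ct1 U L r p by rewrite /Ct1 mulr_ge0 ?powR_ge0.
have Dt1_ge0 : 0 <= Dt1 U L r p by rewrite /Dt1 mulr_ge0 ?powR_ge0.
have hDp : D `^ p <= (2 * Ct1 U L r p + 2) * s `^ p + Dt1 U L r p * (kap `^ p * eta `^ p).
  have e1 : Ct1 U L r p * s `^ p = (2 + r) `^ (1 - p / 2) * (Ct2 U L r p `^ p * s `^ p).
    by rewrite /Ct1 mulrA.
  have e2 : Dt1 U L r p * (kap `^ p * eta `^ p)
      = (2 + r) `^ (1 - p / 2) * (Dt2 U L r p `^ p * (kap `^ p * eta `^ p)).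
    by rewrite /Dt1 -!mulrA.
  (* [C1] retains a factor 2 before [Ct1], so the bound 1 on the power suffices here; the noise term
     [f2] uses the full bound 2. *)
  have f1 : Ct2 U L r p `^ p * s `^ p <= Ct1 U L r p * s `^ p.
    by rewrite e1 ler_peMl // (le_trans _ g2) // ler1n.
  have f2 : 2 * (Dt2 U L r p `^ p * (kap `^ p * eta `^ p))
      <= Dt1 U L r p * (kap `^ p * eta `^ p).
    by rewrite e2 ler_wpM2r.
  move: hD hdp f1 f2; rewrite -mulrA mulrDl; lra.
have q1 : 1 <= p^-1 by rewrite invf_ge1.
have q0 : 0 <= (2 * Ct1 U L r p + 2) by rewrite addr_ge0 // mulr_ge0.
apply: le_trans (ler_powRV p0 D0 _ hDp) _.
  by rewrite addr_ge0 ?mulr_ge0 ?powR_ge0.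
apply: le_trans (powRD_le_convex q1 _ _) _; rewrite ?mulr_ge0 ?powR_ge0 //.
rewrite /C1 /D1 powRM ?powR_ge0 // (@powRM _ (Dt1 _ _ _ _)) ?mulr_ge0 ?powR_ge0 //.
rewrite -(powRM p (ltW kap0) eta0) !powRK ?mulr_ge0 ?(ltW kap0) //.
by rewrite le_eqVlt; apply/orP; left; apply/eqP; ring.
Qed.

End ExplicitConstants.

(** * Assembly of the recovery bounds for a general modulus *)

Lemma thm22_for_modulus (R : realType) (F : nzRingType) (nrm : F -> R) :
  is_modulus nrm -> thm22_for nrm.
Proof.
move=> nrmP m n k p r L U A p0 p1 k0 kn r0 L0 U0 biLip den0 x eta e eta0 he z [feas opt].
have kp : 0 < k%:R :> R by rewrite ltr0n.
have k1 : 1 <= k%:R :> R by rewrite ler1n.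
have rk0 : 0 <= r * k%:R by rewrite mulr_ge0 ?(ltW r0) ?(ltW kp).
(* From [r k < t] follows [t ^ (- a) <= r ^ (- a) / k ^ a], while [t <= r k + 1] and [1 <= k] keep
   [k + k + t] below [(r + 4) k]. *)
pose t := (Num.truncn (r * k%:R)).+1.
have /andP[t_le rk_le] := truncn_itv rk0.
have {}t_le : t%:R <= r * k%:R + 1 by rewrite -natr1 lerD2r.
have sparse (u : 'cV[F]_n) (j : nat) : (l0 u <= j)%N -> (j <= k + k + t)%N ->
    (l0 u)%:R <= (r + 4) * k%:R.
  move=> uj jk; have : ((l0 u)%:R <= (k + k + t)%:R :> R).
    by rewrite ler_nat (leq_trans uj).
  by rewrite !natrD; move: t_le k1; lra.
have X0 : (l0 (0 : 'cV[F]_n))%:R <= (r + 4) * k%:R by apply: (@sparse _ 0%N); rewrite ?l0_0.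
have LU : L <= U.
  (* A vector with a single entry 1 is sparse enough to test both Lipschitz bounds. *)
  pose i0 : 'I_n := Ordinal (leq_trans k0 kn).
  pose u : 'cV[F]_n := restr [set i0]%SET (const_mx 1).
  apply: (biLip_const_le nrmP (u := u) biLip X0).
    have u1 : (l0 u <= 1)%N by apply: (leq_trans (l0_restr _ _)); rewrite cards1.
    by apply: (sparse _ _ u1); rewrite addnS.
  rewrite (qnorm_restr nrmP) ?pnatr_eq0 // big_set1 mxE (modulus1 nrmP).
  by rewrite !powR1.
have x_feas : feasible nrm A eta (absv nrm (A *m x) + e) x.
  by rewrite /feasible opprD addrA subrr add0r rnorm2N.
have zx := opt _ x_feas.
have knn : (0 < k <= n)%N by rewrite k0.
have [S [T0 [T [[cS ST0 T0T] [cT0 cT] xS blocks]]]] :=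
  exists_block_supports nrmP x z p0 p1 knn (isT : (0 < t)%N).
set s := sigmak nrm k p x in xS blocks *.
have s0 : 0 <= s by apply: le_trans xS; exact: qnorm_ge0.
set a := p^-1 - 2^-1 in blocks *.
have a0 : 0 < a by exact: exponent_gt0.
set kap : R := k%:R `^ a.
have kap0 : 0 < kap by rewrite powR_gt0.
have kapN : k%:R `^ (- a) = kap^-1 by rewrite powRN.
have tN : t%:R `^ (- a) <= r `^ (- a) / kap.
  rewrite !powRN -invfM -powRM ?(ltW r0) ?(ltW kp) //.
  rewrite lef_pV2 ?posrE ?powR_gt0 ?mulr_gt0 ?ltr0n //.
  by apply: ler_powRl; rewrite ?(ltW a0) // ltW.
pose h : R := 2 `^ (p^-1 - 1).
have h0 : 0 <= h by exact: powR_ge0.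
pose tau := s / kap.
have tau0 : 0 <= tau by rewrite divr_ge0 // ltW.
pose head c := qnorm nrm 2 (restr T z - c *: restr T0 x).
have tail_z c : nrm c = 1 -> t%:R `^ (- a) * qnorm nrm p (restr (~: S) z)
    <= h * r `^ (- a) * (head c + tau).
  move=> c1; have := qnorm_tail_le nrmP p0 p1 c1 s0 cS ST0 T0T zx xS.
  rewrite -/a -/kap -/h -/(head c) => hz.
  (* The factor [kap] before the head cancels against [tN], and [s / kap] becomes [tau]. *)
  apply: le_trans (ler_pM _ _ tN hz) _; rewrite ?powR_ge0 //.
  rewrite le_eqVlt; apply/orP; left; apply/eqP; rewrite /tau.
  by field; rewrite gt_eqF.
have AD (u w : 'cV[F]_n) : qnorm nrm 2 (A *m (u + w))
    <= qnorm nrm 2 (A *m u) + qnorm nrm 2 (A *m w).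
  by rewrite mulmxDr; exact: qnorm2D.
have AU (u : 'cV[F]_n) : (l0 u <= k + t)%N -> qnorm nrm 2 (A *m u) <= U * qnorm nrm 2 u.
  move=> hu; have Xu : (l0 u)%:R <= (r + 4) * k%:R.
    by apply: (sparse _ _ hu); rewrite leq_add2r leq_addr.
  exact: (biLip_upper nrmP biLip X0 Xu).
have ID (u w : 'cV[F]_n) := qnorm2D nrmP u w.
have IU (u : 'cV[F]_n) : (l0 u <= k + t)%N -> qnorm nrm 2 u <= 1 * qnorm nrm 2 u.
  by move=> _; rewrite [leRHS]mul1r; exact: lexx.
have [bAx bAz] := blocks (fun u => qnorm nrm 2 (A *m u)) U (ltW U0) AD AU.
have [bx bz] := blocks (fun u => qnorm nrm 2 u) 1 ler01 ID IU.
rewrite kapN [kap^-1 * _]mulrC -/tau in bAx bx.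
rewrite [leRHS]mul1r in bx; rewrite [leRHS]mul1r in bz.
pose d := distq nrm 2 (restr T z) (restr T0 x).
have d0 : 0 <= d by exact: (distq_ge0 nrmP).
have meas : rnorm2 (absv nrm (A *m z) - absv nrm (A *m x)) <= 2 * eta.
  have -> : absv nrm (A *m z) - absv nrm (A *m x)
      = absv nrm (A *m z) - (absv nrm (A *m x) + e) + e by rewrite opprD addrA subrK.
  by rewrite [2 * eta]mulr_natl mulr2n; exact: (le_trans (rnorm2D _ _) (lerD feas he)).
have Ld c : nrm c = 1 -> L * d <= U * (h * r `^ (- a)) * head c
    + (2 * eta + U * (h * r `^ (- a) + 1) * tau).
  move=> c1.
  have Xz : (l0 (restr T z))%:R <= (r + 4) * k%:R.
    exact: (sparse _ _ (l0_restr _ _) cT).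
  have Xx : (l0 (restr T0 x))%:R <= (r + 4) * k%:R.
    by apply: (sparse _ _ (l0_restr _ _)); rewrite (leq_trans cT0) // leq_addr.
  have [low _] := biLip _ _ Xz Xx.
  have dz : rnorm2 (absv nrm (A *m restr T z) - absv nrm (A *m z))
      <= U * (h * r `^ (- a) * (head c + tau)).
    apply: le_trans (rnorm2_absvB nrmP _ _) _.
    rewrite -mulmxBr {2}(restr_id z T) opprD addrA subrr add0r mulmxN (qnormN nrmP).
    by apply: (le_trans bAz); rewrite ler_wpM2l ?(ltW U0) // tail_z.
  have dx : rnorm2 (absv nrm (A *m x) - absv nrm (A *m restr T0 x)) <= U * tau.
    apply: le_trans (rnorm2_absvB nrmP _ _) _.
    by rewrite -mulmxBr {1}(restr_id x T0) addrAC subrr add0r.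
  (* Passage from [restr T z] to [restr T0 x] through [z] and [x]: two tails and one measurement
     error. *)
  have e3 : absv nrm (A *m restr T z) - absv nrm (A *m restr T0 x)
    = (absv nrm (A *m restr T z) - absv nrm (A *m z))
      + ((absv nrm (A *m z) - absv nrm (A *m x))
         + (absv nrm (A *m x) - absv nrm (A *m restr T0 x))).
    by rewrite !subrKA.
  rewrite e3 in low.
  have low' := le_trans low (le_trans (rnorm2D _ _) (lerD (lexx _) (rnorm2D _ _))).
  apply: (le_trans (le_trans low' (lerD dz (lerD meas dx)))).
  by rewrite le_eqVlt; apply/orP; left; apply/eqP; ring.
have hd : d <= Ct2 U L r p * tau + Dt2 U L r p * eta.
  apply: head_bound => //.
  have Uh0 : 0 < U * (h * r `^ (- a)) by rewrite !mulr_gt0 ?powR_gt0.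
  (* The infimum over [c] replaces [head c] by [d], so that [head_bound] can absorb it on the
     left. *)
  exact: (le_distq_affine nrmP Uh0 Ld).
split.
  have Dge0 := distq_ge0 nrmP p z x.
  apply: (final_bound1 p0 p1 r0 U0 den0 Dge0 d0 s0 kap0 eta0 LU _ hd).
  have -> : kap `^ p = k%:R `^ (1 - p / 2).
    by rewrite -powRrM; congr (_ `^ _); rewrite /a; field; rewrite gt_eqF.
  have q0 : 0 < 2 * k%:R `^ (1 - p / 2) :> R by rewrite mulr_gt0 ?powR_gt0.
  apply: (le_distq_powR nrmP p0 q0) => c c1.
  apply: (le_trans _ (qnorm_powR_le nrmP p0 p1 c1 cS ST0 T0T zx xS)).
  by apply: (ler_powRl (ltW p0) Dge0); exact: distq_le.
apply: (final_bound2 p0 p1 r0 d0 _ hd).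
apply: (le_distq_affine nrmP) => [|c c1].
  by rewrite ltr_wpDr // mulr_ge0 ?powR_ge0.
apply: le_trans (distq_le _ _ _ c1) _.
(* Head plus two tails, each tail being bounded by the instance of [blocks] for the l2-norm
   itself. *)
have -> : z - c *: x = (restr T z - c *: restr T0 x)
    + (restr (~: T) z + - (c *: restr (~: T0) x)).
  by rewrite {1}(restr_id z T) {1}(restr_id x T0) scalerDr opprD addrACA.
apply: le_trans (qnorm2D nrmP _ _) _.
apply: le_trans (lerD (lexx _) (qnorm2D nrmP _ _)) _.
have -> : qnorm nrm 2 (- (c *: restr (~: T0) x)) = qnorm nrm 2 (restr (~: T0) x).
  rewrite (qnormN nrmP); congr (_ `^ _); apply: eq_bigr => i _.
  by rewrite mxE (modulusM nrmP) c1 mul1r.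
apply: le_trans (lerD (lexx _) (lerD (le_trans bz (tail_z c c1)) bx)) _.
by rewrite le_eqVlt; apply/orP; left; apply/eqP; rewrite -/(head c) -/h -/a -/tau; ring.
Qed.

Theorem theorem2p2 (R : realType) :
  @thm22_for R R (fun a : R => `|a|) /\ @thm22_for R (R[i]) (@Normc.normc R).
Proof.
split; apply: thm22_for_modulus; [exact: normr_is_modulus|exact: normc_is_modulus].
Qed.
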